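(* Write $P_n(x)=\sum_{k=0}^{n}Q_k^n x^k$. Then for every $n\ge 1$, $$Q_0^n=Q_1^{n-1},$$ $$Q_k^n=n\,Q_{k-1}^{n-1}+(k+1)\,Q_{k+1}^{n-1}\quad\text{for } k=1,\ldots,n-2,$$ $$Q_k^n=n\,Q_{k-1}^{n-1}\quad\text{for } k=n-1,\,n.$$
   Context: The polynomials $P_n(x)$, $n\ge 0$, are defined by $P_0(x)=1$ and $P_n(x)=P_{n-1}'(x)+n x P_{n-1}(x)$ for $n\ge 1$; $P_n$ has degree $n$. The superscript in $Q_k^n$ is an index, not a power. By convention $Q_k^m=0$ if $k<0$ or $k>m$. *)

(* Defs.v *)
From mathcomp Require Import all_boot all_order all_algebra.
Set Implicit Arguments.
Unset Strict Implicit.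
Unset Printing Implicit Defensive.
Import Order.TTheory GRing.Theory Num.Theory.
Local Open Scope ring_scope.

(* The coefficients are integers, read in an arbitrary numDomainType
   so that int, rat, real and complex polynomials are covered. *)
Fixpoint P (R : numDomainType) (n : nat) : {poly R} :=
  if n is m.+1 then (P R m)^`() + n%:R *: ('X * P R m) else 1.

(* The index k is an integer because Q_{-1}^0 does occur (n = 1, k = n - 1);
   outside 0 <= k <= m the value is 0 by convention. *)
Definition Q (R : numDomainType) (m : nat) (k : int) : R :=
  if (0 <= k) && (k <= m%:Z) then (P R m)`_(`|k|%N) else 0.

(* Main.v *)
Require Import Defs.
From mathcomp Require Import all_boot all_order all_algebra.
Set Implicit Arguments.
Unset Strict Implicit.
Unset Printing Implicit Defensive.
Import Order.TTheory GRing.Theory Num.Theory.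
Local Open Scope ring_scope.

(** Compare coefficients of [x^k] in the recurrence for [P]: multiplication by [x] shifts the index
    down by one, differentiation shifts it up and brings out the factor [k + 1]. This gives a single
    identity, [Q_rec], for every natural [k]. The cases of the theorem record which of its two terms
    vanish: the first at [k = 0], the second once [k + 1] exceeds the degree bound of [size_P]. *)

Lemma size_P (R : numDomainType) (n : nat) : (size (P R n) <= n.+1)%N.
Proof.
elim: n => [|n IHn]; first by rewrite size_poly1.
rewrite [P R n.+1]/=; apply: leq_trans (size_polyD _ _) _.
rewrite geq_max; apply/andP; split.
  apply: leq_trans (size_poly _ _) _.
  by rewrite (leq_trans (leq_pred _)) // leqW.
apply: leq_trans (size_scale_leq _ _) _; rewrite mulrC.
by apply: leq_trans (size_polyMleq _ _) _; rewrite size_polyX addn2.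
Qed.

(** By [size_P] the coefficients past [m] are already zero, so the upper cutoff in [Q] agrees with
    [P] and identities on [Q] reduce to identities on polynomial coefficients. *)
Lemma Q_nat (R : numDomainType) (m k : nat) : Q R m k%:Z = (P R m)`_k.
Proof.
rewrite /Q lez_nat /=; case: leqP => // lt_mk.
by rewrite nth_default // (leq_trans (size_P R m)).
Qed.

Lemma Q_gt (R : numDomainType) (m : nat) (k : int) : m%:Z < k -> Q R m k = 0.
Proof. by move=> lt_mk; rewrite /Q [k <= _]leNgt lt_mk andbF. Qed.

(* The convention Q_{-1}^n = 0 absorbs the case k = 0. *)
Lemma Q_rec (R : numDomainType) (n k : nat) :
  Q R n.+1 k%:Z = n.+1%:R * Q R n (k%:Z - 1)
                  + (k%:Z + 1)%:~R * Q R n (k%:Z + 1).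
Proof.
have -> : k%:Z + 1 = k.+1%:Z by rewrite intS addrC.
rewrite !Q_nat [P R n.+1]/= coefD coef_deriv coefZ coefXM addrC.
rewrite -[k.+1%:~R]/(k.+1%:R) [k.+1%:R * _]mulr_natl.
by case: k => [|k]; rewrite //= intS addrAC subrr add0r Q_nat.
Qed.

Theorem lemma7 (R : numDomainType) :
  (forall n : nat, P R n = \sum_(k < n.+1) Q R n k%:Z *: 'X^k) /\
  (forall n : nat, (1 <= n)%N ->
    [/\ Q R n 0 = Q R (n - 1)%N 1,
        forall k : int, 1 <= k -> k <= n%:Z - 2 ->
          Q R n k = n%:R * Q R (n - 1)%N (k - 1)
                    + (k + 1)%:~R * Q R (n - 1)%N (k + 1)
      & forall k : int, k = n%:Z - 1 \/ k = n%:Z ->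
          Q R n k = n%:R * Q R (n - 1)%N (k - 1)]).
Proof.
split=> [n | [//|n] _].
  under eq_bigr => k _ do rewrite Q_nat.
  rewrite -poly_def; apply/polyP=> i.
  (* The sum has no term of index [i > n], where the coefficient of [P] must be shown to vanish. *)
  by rewrite coef_poly -Q_nat; case: ltnP => // lt_ni; rewrite Q_gt.
rewrite subn1 /=; split.
- by rewrite Q_rec /= mulr0 add0r mul1r.
- by move=> [k|//] _ _; rewrite Q_rec.
- move=> k; rewrite intS addrAC subrr add0r => Dk.
  (* With [n] now the predecessor, [k] is [n] or [n + 1]: it is natural, so [Q_rec] applies, and
     [k + 1] lies beyond [n], which kills the derivative term. For [n = 0] and [k = 0] the remaining
     term has index -1. *)
  have [-> le_nk] : k = `|k|%N%:Z /\ n%:Z < k + 1.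
    by case: Dk => ->; split=> //; rewrite ?ltzD1 // lerDr.
  by rewrite Q_rec [Q R n (_ + 1)]Q_gt ?mulr0 ?addr0.
Qed.
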